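(* There is a deterministic distributed algorithm in the broadcast congested clique model that computes a maximal independent set of the input graph $G$ within $O(\log \Delta \log n)$ rounds, where $n$ is the number of nodes and $\Delta$ the maximum degree of $G$.
   Context: The input is an undirected graph $G=(V,E)$ with $n=|V|$ nodes, each node knowing its own unique $O(\log n)$-bit identifier and its incident edges. In the broadcast congested clique model, computation proceeds in synchronous rounds; in each round every node sends one and the same $O(\log n)$-bit message to all other $n-1$ nodes (communication is all-to-all, independent of $G$), and local computation is free. A maximal independent set is a set $I\subseteq V$ with no two nodes of $I$ adjacent in $G$ such that every node of $V\setminus I$ has a neighbor in $I$; at the end every node must know whether it belongs to $I$. *)

(* Defs.v *)
From mathcomp Require Import all_boot.
Set Implicit Arguments. Unset Strict Implicit. Unset Printing Implicit Defensive.

Definition simple_graph (n : nat) (e : rel 'I_n) : Prop :=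
  (forall u v, e u v = e v u) /\ (forall v, ~~ e v v).

Definition max_degree (n : nat) (e : rel 'I_n) : nat :=
  \max_(v : 'I_n) #|[set u | e v u]|.

Definition independent (n : nat) (e : rel 'I_n) (I : {set 'I_n}) : Prop :=
  forall u v, u \in I -> v \in I -> ~~ e u v.
Definition maximal_independent_set (n : nat) (e : rel 'I_n) (I : {set 'I_n}) : Prop :=
  independent e I /\ (forall v, v \notin I -> exists2 u, u \in I & e v u).

(* What a node receives in one round: for every identifier x, [Some m] if the
   node with identifier x broadcast message m, and [None] if no node has
   identifier x.  Messages are natural numbers (bit strings). *)
Definition round_view := nat -> option nat.

(* A deterministic broadcast-congested-clique algorithm.  Local computation is
   free, so a node's state is its full knowledge: n, its own identifier, the
   identifiers of its neighbours (its incident edges), and the history of all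
   rounds so far.  [bcast] is the message broadcast in the next round,
   [output] is [Some b] once the node has halted with output b
   (b = "I am in the MIS"). *)
Record bcc_algorithm := BCCAlgorithm {
  bcast  : nat -> nat -> (nat -> bool) -> seq round_view -> nat;
  output : nat -> nat -> (nat -> bool) -> seq round_view -> option bool
}.

Section Execution.
Variables (A : bcc_algorithm) (n : nat) (e : rel 'I_n) (id : 'I_n -> nat).

Definition nbr_ids (v : 'I_n) : nat -> bool :=
  fun x => [exists u, e v u && (id u == x)].

Fixpoint history (t : nat) : 'I_n -> seq round_view :=
  match t with
  | 0 => fun _ => [::]
  | t'.+1 =>
      let h := history t' in
      let view : round_view := fun x =>
        match [pick u | id u == x] with
        | Some u => Some (bcast A n (id u) (nbr_ids u) (h u))
        | None => None
        end in
      fun v => rcons (h v) view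
  end.

(* message broadcast by v in round t+1 *)
Definition sent (t : nat) (v : 'I_n) : nat :=
  bcast A n (id v) (nbr_ids v) (history t v).

Definition status (t : nat) (v : 'I_n) : option bool :=
  output A n (id v) (nbr_ids v) (history t v).
End Execution.

(* A computes an MIS of G within T rounds, all messages having fewer than
   b * (log2 n + 1) bits: every node has halted after T rounds, and the
   outputs (never revoked) are the indicator of a maximal independent set. *)
Definition bcc_computes_mis_within (A : bcc_algorithm) (b : nat)
  (n : nat) (e : rel 'I_n) (id : 'I_n -> nat) (T : nat) : Prop :=
  (forall t v, sent A e id t v < 2 ^ (b * (trunc_log 2 n).+1)) /\
  exists2 I : {set 'I_n}, maximal_independent_set e I &
    (forall v, status A e id T v <> None) /\
    (forall t v bo, status A e id t v = Some bo -> bo = (v \in I)).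

(* Main.v *)
From Stdlib Require Import FunctionalExtensionality.
Require Import Defs.
From mathcomp Require Import all_boot all_algebra all_field zify.
Set Implicit Arguments. Unset Strict Implicit. Unset Printing Implicit Defensive.

(** If [Delta < log n + 1], every node broadcasts its whole neighbour list and
    all nodes compute the same maximal independent set locally.

    Otherwise run Luby's algorithm: in each phase a node of live degree [d] marks
    itself with probability about [1 / (8 d)] and joins if no marked neighbour has
    at least its degree.  The marks come from the hash
    [x |-> a * P_x(al) + b] with seed [(al, a, b)] over the field with [2 ^ k] elements, where
    the coefficients of [P_x] are the bits of the identifier [x].  Two identifiers
    collide under evaluation for at most [O(log n)] values [al], so
    [2 ^ k = O(Delta * log n) = O(Delta ^ 2)] already makes the marks of neighbours
    almost pairwise independent: the seed has only [O(log Delta)] bits.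

    The seed is found by conditional expectations, halving the set of seeds at the
    cost of two broadcasts.  The estimator must be a sum of terms each known to a
    single node.  Each node [v] restricts attention to a set of lower-degree
    neighbours whose marking probabilities add up to at most 1/4, described by one
    broadcast number (a cutoff on identifiers); then
    [gain - loss] bounds from below the sum of degrees of the nodes removed, by
    inclusion-exclusion, and its mean is a constant fraction of the number of live
    edges.  Hence [O(log n)] phases kill every edge, and the nodes still
    live at the end may all join. *)

(** * Protocols *)

(** All histories coincide, so an algorithm is a tree of public states: each round
    has a message depending on the private input, and a continuation depending on
    the round's (public) view. *)
Inductive protocol (R : Type) :=
  | Ret of R
  | Round of (nat -> (nat -> bool) -> nat) & (round_view -> protocol R).

Fixpoint bind R S (p : protocol R) (k : R -> protocol S) : protocol S :=
  match p with
  | Ret r => k r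
  | Round m c => Round m (fun w => bind (c w) k)
  end.

Definition advance R (p : protocol R) (w : round_view) : protocol R :=
  if p is Round _ c then c w else p.

Definition algorithm_of (P : nat -> protocol (nat -> bool)) : bcc_algorithm :=
  BCCAlgorithm
    (fun n x N h => if foldl (@advance _) (P n) h is Round m _ then m x N else 0)
    (fun n x N h => if foldl (@advance _) (P n) h is Ret r then Some (r x) else None).

Definition broadcast (f : nat -> (nat -> bool) -> nat) : protocol (nat -> nat) :=
  Round f (fun w => Ret (fun x => odflt 0 (w x))).

(** * Semantics of protocols: executions, rounds and message sizes *)

Section Semantics.
Variables (n : nat) (e : rel 'I_n) (id : 'I_n -> nat).
Hypothesis id_inj : injective id.

(** Naturals that are no node's identifier are treated as isolated vertices. *)
Definition adj (x : nat) : nat -> bool :=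
  if [pick u | id u == x] is Some u then nbr_ids e id u else fun=> false.

Definition view_of (m : nat -> (nat -> bool) -> nat) : round_view := fun x =>
  match [pick u | id u == x] with
  | Some u => Some (m (id u) (nbr_ids e id u))
  | None => None
  end.

Lemma pick_id v : [pick u | id u == id v] = Some v.
Proof.
by case: pickP => [u /eqP/id_inj-> // | /(_ v)]; rewrite eqxx.
Qed.

Lemma adj_id v : adj (id v) = nbr_ids e id v.
Proof. by rewrite /adj pick_id. Qed.

Lemma adj_idE u v : adj (id u) (id v) = e u v.
Proof.
rewrite adj_id /nbr_ids; apply/existsP/idP => [[w /andP[euw /eqP/id_inj <-]] //|euv].
by exists v; rewrite euv eqxx.
Qed.

Lemma adjP x y : reflect (exists u v, [/\ x = id u, y = id v & e u v]) (adj x y).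
Proof.
apply: (iffP idP) => [|[u [v [-> -> euv]]]]; last by rewrite adj_idE.
rewrite /adj; case: pickP => [u /eqP<-|//] /existsP[v /andP[euv /eqP<-]].
by exists u, v.
Qed.

(** A missing identifier is decoded as 0, so decoding agrees with the message function everywhere
    once that function yields 0 on an empty neighbourhood. *)
Lemma view_ofE m x : (adj x =1 xpred0 -> m x (adj x) = 0) ->
  odflt 0 (view_of m x) = m x (adj x).
Proof.
rewrite /view_of /adj; case: pickP => [u /eqP <- //|_] /= m0.
by rewrite m0.
Qed.

Section Spec.
Variable M : nat.

(** Only the actual execution on the given graph is followed, through [view_of]; [T] bounds the
    rounds and [M] the messages. *)
Fixpoint spec R (p : protocol R) (T : nat) (Q : R -> Prop) : Prop :=
  match p with
  | Ret r => Q r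
  | Round m c =>
      if T is T'.+1 then
        (forall v, m (id v) (nbr_ids e id v) < M) /\ spec (c (view_of m)) T' Q
      else False
  end.

Lemma spec_weaken R (p : protocol R) T T' (Q Q' : R -> Prop) :
  T <= T' -> (forall r, Q r -> Q' r) -> spec p T Q -> spec p T' Q'.
Proof.
elim: p T T' => [r|m c IH] [|T] [|T'] //= leTT QQ'; try exact: QQ'.
by move=> [mM sp]; split=> //; apply: IH sp.
Qed.

Lemma spec_Ret R (r : R) T (Q : R -> Prop) : Q r -> spec (Ret r) T Q.
Proof. by []. Qed.

Lemma spec_bind R S (p : protocol R) (k : R -> protocol S) T1 T2 Q Q' :
  spec p T1 Q -> (forall r, Q r -> spec (k r) T2 Q') ->
  spec (bind p k) (T1 + T2) Q'.
Proof.
elim: p T1 => [r|m c IH] [|T1] //= sp sk.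
- exact: sk.
- by apply: spec_weaken (sk _ sp); rewrite ?leq_addl.
by case: sp => mM sp; split=> //; apply: IH.
Qed.

Lemma spec_broadcast f :
  (forall x, f x (adj x) < M) ->
  (forall x, adj x =1 xpred0 -> f x (adj x) = 0) ->
  spec (broadcast f) 1 (fun w => forall x, w x = f x (adj x)).
Proof.
move=> fM f0; split=> [v|x /=]; first by rewrite -adj_id.
exact/view_ofE/f0.
Qed.

End Spec.

Fixpoint run R (p : protocol R) (t : nat) : protocol R :=
  if t is t'.+1 then
    let q := run p t' in
    if q is Round m c then c (view_of m) else q
  else p.

Lemma run_Ret R (r : R) t : run (Ret r) t = Ret r.
Proof. by elim: t => //= t ->. Qed.

Lemma run_Round R m (c : round_view -> protocol R) t :
  run (Round m c) t.+1 = run (c (view_of m)) t.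
Proof. by elim: t => //= t <-. Qed.

Lemma spec_run R M (p : protocol R) T Q : spec M p T Q ->
  exists r, [/\ Q r, run p T = Ret r,
   forall t r', run p t = Ret r' -> r' = r &
   forall t, if run p t is Round m _ then
     forall v, m (id v) (nbr_ids e id v) < M else True].
Proof.
elim: p T => [r|m c IH] T /=.
  move=> Qr; exists r; split=> // [|t r'|t]; rewrite run_Ret //.
  by case.
case: T => [//|T] [mM /IH[r [Qr runr uniqr boundr]]].
exists r; split=> // [|[//|t] r'|[//|t]]; rewrite run_Round //.
  exact: uniqr.
exact: boundr.
Qed.

(** All nodes receive the same view, so replaying it leads each of them to the same public state,
    whatever [v] is. *)
Lemma history_run P t v :
  foldl (@advance _) (P n) (history (algorithm_of P) e id t v) = run (P n) t.
Proof.
elim: t v => [//|t IH] v /=; rewrite foldl_rcons IH.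
case E: (run (P n) t) => [r|m c] //=; congr (c _).
apply: functional_extensionality => x.
by rewrite /view_of; case: pickP => // u _; rewrite IH E.
Qed.

Lemma spec_computes_mis (P : nat -> protocol (nat -> bool)) b T :
  spec (2 ^ (b * (trunc_log 2 n).+1)) (P n) T
    (fun r => maximal_independent_set e [set v | r (id v)]) ->
  bcc_computes_mis_within (algorithm_of P) b e id T.
Proof.
case/spec_run=> r [misr runT uniqr boundr]; split.
  move=> t v; rewrite /sent /= history_run.
  have := boundr t; case: (run _ t) => [_ _|m c]; last exact.
  by rewrite expn_gt0.
exists [set v | r (id v)] => //; split=> [v|t v bo].
  by rewrite /status /= history_run runT.
rewrite /status /= history_run inE.
case E: (run _ t) => [r'|//] [<-].
by rewrite (uniqr _ _ E).
Qed.

End Semantics.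

(** * Almost pairwise independent hashing *)

Lemma bits_inj D x y : x < 2 ^ D -> y < 2 ^ D ->
  (forall i, i < D -> odd (x %/ 2 ^ i) = odd (y %/ 2 ^ i)) -> x = y.
Proof.
elim: D x y => [|D IH] x y; first by rewrite expn0 !ltnS !leqn0 => /eqP-> /eqP->.
rewrite expnS => xD yD bits.
have := bits 0 isT; rewrite expn0 !divn1 => odd_xy.
have half_xy : x %/ 2 = y %/ 2.
  apply: IH; try lia.
  by move=> i iD; rewrite -!divnMA -expnS bits.
by rewrite -(odd_double_half x) -(odd_double_half y) -!divn2 odd_xy half_xy.
Qed.

Lemma sum_ltn m t : t <= m -> \sum_(0 <= i < m) (i < t) = t.
Proof.
move=> tm; rewrite (big_cat_nat (n := t)) //= [X in _ + X]big_nat.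
rewrite [X in _ + X]big1 ?addn0 => [|i]; last by lia.
rewrite big_nat (eq_bigr (fun=> 1)) => [|i]; last by lia.
by rewrite -big_nat sum_nat_const_nat subn0 muln1.
Qed.

Lemma sum_nth_enum (T : finType) (t0 : T) (G : T -> nat) :
  \sum_(0 <= s < #|T|) G (nth t0 (enum T) s) = \sum_t G t.
Proof. by rewrite -[in RHS]big_enum (big_nth t0) -cardE. Qed.

Lemma sum_index_enum (T : finType) t : t <= #|T| ->
  \sum_(z : T) (index z (enum T) < t) = t.
Proof.
move=> tT; case: (pickP T) => [t0 _|T0]; last first.
  by move: tT; rewrite (eq_card0 T0) leqn0 => /eqP->; apply: big1.
rewrite -(sum_nth_enum t0) -[RHS](sum_ltn tT) big_nat [RHS]big_nat.
by apply: eq_bigr => s sT; rewrite index_uniq ?enum_uniq -?cardE.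
Qed.

Section AffineHash.
Variable F : finFieldType.
Import GRing.Theory.
Local Notation rank z := (index (z : F) (enum F)).

Definition bit_poly D x : {poly F} :=
  (\poly_(i < D) (odd (x %/ 2 ^ i))%:R)%R.

(** The two polynomials differ in some coefficient, since 0 and 1 differ in [F]; their difference
    has size at most [D] and so fewer than [D] roots. *)
Lemma card_bit_poly_collisions D x y :
  x < 2 ^ D -> y < 2 ^ D -> x != y ->
  \sum_(al : F) ((bit_poly D x).[al] == (bit_poly D y).[al])%R <= D.
Proof.
move=> xD yD neq_xy; pose p := (bit_poly D x - bit_poly D y)%R.
have p_neq0 : p != 0%R.
  apply: contraNneq neq_xy => p0; apply/eqP/(bits_inj xD yD) => i iD.
  have /polyP/(_ i) : bit_poly D x = bit_poly D y.
    by apply/eqP; rewrite -GRing.subr_eq0 -/p p0.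
  rewrite !coef_poly iD; case: odd; case: odd => //=.
    by move/eqP; rewrite oner_eq0.
  by move/esym/eqP; rewrite oner_eq0.
rewrite -big_mkcond sum1_card cardE.
apply: leq_trans (_ : size p <= D); last first.
  by rewrite (leq_trans (size_polyD _ _)) // size_polyN geq_max !size_poly.
apply/ltnW/max_poly_roots => //; last exact: enum_uniq.
by apply/allP => al; rewrite mem_enum unfold_in /= rootE !hornerE subr_eq0.
Qed.

Definition affine_hash D (s : F * F * F) x : F :=
  (s.1.2 * (bit_poly D x).[s.1.1] + s.2)%R.

Lemma sum_shift (c : F) (G : F -> nat) : \sum_b G (c + b)%R = \sum_b G b.
Proof.
rewrite [RHS](reindex (fun b => c + b)%R) //.
by exists (fun b => b - c)%R => b _; rewrite addrC ?addKr ?addrK // subrK.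
Qed.

Lemma sum_seed (G : F * F * F -> nat) :
  \sum_s G s = \sum_al \sum_a \sum_b G (al, a, b).
Proof.
rewrite pair_big /= pair_big /=; apply: eq_bigr => [[[al a] b]] //.
Qed.

(** For fixed [al] and [a], the shift by [b] makes the hash value uniform. *)
Lemma sum_affine_hash D x t : t <= #|F| ->
  \sum_s (rank (affine_hash D s x) < t) = #|F| ^ 2 * t.
Proof.
move=> tF; rewrite sum_seed.
rewrite (eq_bigr (fun=> \sum_(a : F) t)) => [|al _]; last first.
  apply: eq_bigr => a _; apply: etrans (sum_index_enum tF).
  exact: (sum_shift (a * (bit_poly D x).[al])%R (fun z => rank z < t : nat)).
by rewrite !sum_nat_const -mulnn mulnA.
Qed.

(** A line is determined by its values at two distinct points, so [(a, b)] corresponds bijectively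
    to the pair of values. *)
Lemma sum_affine_pair (c c' : F) t t' : c != c' -> t <= #|F| -> t' <= #|F| ->
  \sum_a \sum_b (rank (a * c + b)%R < t) * (rank (a * c' + b)%R < t') = t * t'.
Proof.
move=> neq_c tF t'F.
have d0 : (c - c' != 0)%R by rewrite subr_eq0.
pose f (p : F * F) := (p.1 * c + p.2, p.1 * c' + p.2)%R.
have fbij : bijective f.
  pose a (p : F * F) := ((p.1 - p.2) / (c - c'))%R.
  exists (fun p => (a p, p.1 - a p * c)%R) => [[u v]|[u v]]; rewrite /f /a /=.
    have -> : (u * c + v - (u * c' + v))%R = (u * (c - c'))%R.
      by rewrite mulrBr opprD addrACA subrr addr0.
    by rewrite mulfK // addrC addKr.
  rewrite [(_ * c + _)%R]addrC subrK; congr pair.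
  rewrite addrCA -mulrBr -[(c' - c)%R]opprB mulrN divfK // opprB.
  by rewrite addrC subrK.
rewrite pair_big /=.
under eq_bigr => p _ do
  rewrite -[(p.1 * c + _)%R]/(f p).1 -[(p.1 * c' + _)%R]/(f p).2.
rewrite -(reindex (P := xpredT)
  (F := fun p => (rank p.1 < t) * (rank p.2 < t') : nat) f); last exact: onW_bij.
rewrite -(pair_big xpredT xpredT
  (fun u v => (rank u < t) * (rank v < t') : nat)) /=.
under eq_bigr => u _ do rewrite -big_distrr /= sum_index_enum //.
by rewrite -big_distrl /= sum_index_enum.
Qed.

(** Without a collision at [al] the two marks are independent over [(a, b)]. At each of the at most
    [D] colliding [al] the second mark is dropped, leaving [#|F| * t]. *)
Lemma sum_affine_hash_pair D x y t t' :
  x < 2 ^ D -> y < 2 ^ D -> x != y -> t <= #|F| -> t' <= #|F| ->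
  \sum_s (rank (affine_hash D s x) < t) * (rank (affine_hash D s y) < t')
    <= #|F| * (t * t') + D * (#|F| * t).
Proof.
move=> xD yD neq_xy tF t'F; rewrite sum_seed /affine_hash /=.
apply: leq_trans (leq_add (leqnn _)
  (leq_mul (card_bit_poly_collisions xD yD neq_xy) (leqnn _))).
rewrite big_distrl /= -sum_nat_const -big_split /=; apply: leq_sum => al _.
case: eqVneq => [->|neq]; last by rewrite sum_affine_pair ?leq_addr.
rewrite mul1n; apply: leq_trans (leq_addl _ _).
rewrite -sum_nat_const; apply: leq_sum => a _.
set z := (a * _)%R.
rewrite -[leqRHS](sum_index_enum tF).
rewrite -(sum_shift z (fun w => rank w < t : nat)) /=.
by apply: leq_sum => b _; case: (_ < t); case: (_ < t').
Qed.

End AffineHash.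

Definition hash_family (k D : nat) (h : nat -> nat -> nat) : Prop :=
  (forall x t, t <= 2 ^ k ->
     \sum_(0 <= s < 2 ^ (3 * k)) (h s x < t) = (2 ^ k) ^ 2 * t) /\
  (forall x y t t', x < 2 ^ D -> y < 2 ^ D -> x != y -> t <= 2 ^ k -> t' <= 2 ^ k ->
     \sum_(0 <= s < 2 ^ (3 * k)) (h s x < t) * (h s y < t')
       <= 2 ^ k * (t * t') + D * (2 ^ k * t)).

(** Seeds number the triples of field elements, whence [3 * k] bits. No field has one element, so
    [k = 0] gets a dummy function. *)
Lemma hash_family_exists k D : {h | 0 < k -> hash_family k D h}.
Proof.
case: k => [|k]; first by exists (fun _ _ => 0).
have [F _ cardF] := pPrimePowerField (isT : prime 2) (isT : 0 < k.+1).
pose dec s := nth (0, 0, 0)%R (enum {: F * F * F}) s.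
exists (fun s x => index (affine_hash D (dec s) x) (enum F)) => _.
have cardS : 2 ^ (3 * k.+1) = #|{: F * F * F}|.
  by rewrite !card_prod cardF -!expnD; congr (2 ^ _); lia.
rewrite /hash_family cardS -cardF; split=> [x t tF|x y t t' xD yD neq tF t'F].
  rewrite (sum_nth_enum _
    (fun s => index (affine_hash D s x) (enum F) < t : nat)).
  exact: sum_affine_hash.
rewrite (sum_nth_enum _ (fun s =>
  (index (affine_hash D s x) (enum F) < t)
  * (index (affine_hash D s y) (enum F) < t') : nat)).
exact: sum_affine_hash_pair.
Qed.

(** * Luby phases *)

Section LubyRules.
Variables (B q : nat) (h : nat -> nat -> nat).

Definition live_degree (live : nat -> bool) (x : nat) (N : nat -> bool) : nat :=
  live x * \sum_(y < B | N y) live y.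

Variable d : nat -> nat.

(** Division by 0 gives 0, so nodes of live degree 0, in particular dead ones, are never marked. *)
Definition threshold (x : nat) : nat := q %/ (8 * d x).

Definition marked (s x : nat) : bool := h s x < threshold x.

Definition low (x y : nat) : bool := 0 < d y <= d x.

(** The test on [has] makes the value [0] for a non-identifier, from which nothing
    is ever received. *)
Definition cutoff (x : nat) (N : nat -> bool) : nat :=
  if has N (iota 0 B) then
    \max_(i < B.+1 | 4 * \sum_(y < B | [&& N y, low x y & y < i]) threshold y <= q) i
  else 0.

Variable cut : nat -> nat.

Definition starred (x : nat) (N : nat -> bool) (y : nat) : bool :=
  [&& N y, low x y & y < cut x].

(** The condition says that [y] stars [x], in a form that [x] can evaluate from its own neighbours
    and the public [d] and [cut]. *)
Definition weight (x : nat) (N : nat -> bool) : nat :=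
  \sum_(y < B | [&& N y, low y x & x < cut y]) d y.

Definition conflicts (s x : nat) (N : nat -> bool) : nat :=
  \sum_(y < B | N y && (d x <= d y)) marked s y.

Definition gain (s x : nat) (N : nat -> bool) : nat := weight x N * marked s x.

(** The first term charges marked nodes that a conflict may block, the second the multiple counting
    of a node with several marked starred neighbours. *)
Definition loss (s x : nat) (N : nat -> bool) : nat :=
  weight x N * (marked s x * conflicts s x N) +
  d x * \sum_(u < B | starred x N u)
          \sum_(w < B | starred x N w && (w != u)) marked s u * marked s w.

Definition joins (s x : nat) (N : nat -> bool) : bool :=
  marked s x && (conflicts s x N == 0).

End LubyRules.

(** * Average progress of one Luby phase *)

Section LubyAnalysis.
Variables (B k D Delta : nat) (h : nat -> nat -> nat) (a : nat -> nat -> bool).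
Variables (live : nat -> bool) (d cut : nat -> nat).
Local Notation q := (2 ^ k).
Hypothesis B_def : B = 2 ^ D.
Hypothesis h_family : hash_family k D h.
Hypothesis a_sym : forall x y, a x y = a y x.
Hypothesis a_irr : forall x, ~~ a x x.
Hypothesis a_deg : forall x, \sum_(y < B | a x y) 1 <= Delta.
Hypothesis q_large : 8 * (Delta * D) <= q.
Hypothesis q_deg : 8 * Delta <= q.
Hypothesis d_def : forall x, d x = live_degree B live x (a x).
Hypothesis cut_def : forall x, cut x = cutoff B q d x (a x).

Local Notation thr := (threshold q d).
Local Notation mk s x := (nat_of_bool (marked q h d s x)).
Local Notation star x y := (starred d cut x (a x) y).

Lemma live_gt0 x y : y < B -> a x y -> live x -> live y -> 0 < d x.
Proof.
move=> yB axy lx ly; rewrite d_def /live_degree lx mul1n.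
by rewrite (bigD1 (Ordinal yB)) //= ly.
Qed.

Lemma degree_le x : d x <= Delta.
Proof.
rewrite d_def /live_degree; apply: leq_trans (a_deg x).
case: (live x); rewrite ?mul0n // mul1n.
by apply: leq_sum => y _; case: (live y).
Qed.

Lemma threshold_le x : thr x <= q.
Proof. exact: leq_div. Qed.

Lemma degree_threshold_le x : 8 * d x * thr x <= q.
Proof. by rewrite mulnC leq_divM. Qed.

(** As [8 * d x <= q], the quotient is at least 1 and rounding down loses at most a factor 2. *)
Lemma degree_threshold_ge x : 0 < d x -> q <= 16 * d x * thr x.
Proof.
move=> dx; have := degree_le x; have := divn_eq q (8 * d x).
have : q %% (8 * d x) < 8 * d x by rewrite ltn_mod; lia.
rewrite -/(thr x) => mod_lt eq_q dD.
have thr_gt0 : 0 < thr x by rewrite /threshold divn_gt0; lia.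
nia.
Qed.

Lemma cutoff_sum_le x : 4 * \sum_(y < B | star x y) thr y <= q.
Proof.
rewrite /starred cut_def /cutoff; case: ifP => [_|_]; last first.
  by rewrite big_pred0 ?muln0 // => y; rewrite ltn0 !andbF.
pose P (i : 'I_B.+1) := 4 * \sum_(y < B | [&& a x y, low d x y & y < i]) thr y <= q.
have P0 : P ord0.
  by rewrite /P big_pred0 ?muln0 // => y; rewrite ltn0 !andbF.
have [|i Pi ->] := @eq_bigmax_cond _ P (fun i => i : nat).
  by apply/card_gt0P; exists ord0.
exact: Pi.
Qed.

(** If the cutoff reaches [B], every low neighbour is starred and has threshold at least
    [q / (16 * d x)]. Otherwise one more identifier, of threshold at most [q / 8], would push the
    sum above [q / 4]; so the sum already exceeds [q / 8], while there are at most [d x] low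
    neighbours. *)
Lemma cutoff_sum_ge x :
  q * \sum_(y < B | a x y && low d x y) 1 <= 16 * d x * \sum_(y < B | star x y) thr y.
Proof.
have [dx0|dx0] := posnP (d x).
  rewrite big_pred0 ?muln0 // => y; rewrite /low dx0.
  by case: (d y) => [|?]; rewrite ?andbF.
have low_le : \sum_(y < B | a x y && low d x y) 1 <= d x.
  rewrite d_def /live_degree; move: dx0; rewrite {1}d_def /live_degree.
  case: (live x) => // _; rewrite mul1n [leqRHS]big_mkcond [leqLHS]big_mkcond.
  apply: leq_sum => y _; case: (a x y) => //=; rewrite /low.
  by case ly: (live y) => //; case: ifP => //; rewrite [d y]d_def /live_degree ly.
have hasN : has (a x) (iota 0 B).
  move: dx0; rewrite d_def /live_degree; apply: contraTT => /hasPn no.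
  rewrite big_pred0 ?muln0 // => y; apply/negbTE/no.
  by rewrite mem_iota ltn_ord.
have cut_le i : i <= B ->
    4 * \sum_(y < B | [&& a x y, low d x y & y < i]) thr y <= q -> i <= cut x.
  move=> iB Pi; rewrite cut_def /cutoff hasN.
  exact: (@leq_bigmax_cond _ (fun j : 'I_B.+1 =>
    4 * \sum_(y < B | [&& a x y, low d x y & y < j]) thr y <= q)
    (fun j => j : nat) (Ordinal (iB : i < B.+1)) Pi).
have [cutB|cutB] := leqP B (cut x).
  rewrite mulnC big_distrl big_distrr /=.
  rewrite [leqRHS](eq_bigl (fun y : 'I_B => a x y && low d x y)); last first.
    by move=> y; rewrite /starred (leq_trans (ltn_ord y) cutB) andbT.
  apply: leq_sum => y /andP[_ /andP[dy0 dyx]]; rewrite mul1n.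
  apply: leq_trans (degree_threshold_ge dy0) _.
  by rewrite leq_mul2r leq_mul2l dyx !orbT.
have over : q < 4 * \sum_(y < B | [&& a x y, low d x y & y < (cut x).+1]) thr y.
  rewrite ltnNge; apply: contraTN isT => /(cut_le _ cutB).
  by rewrite ltnn.
have : \sum_(y < B | [&& a x y, low d x y & y < (cut x).+1]) thr y
   <= \sum_(y < B | star x y) thr y + q %/ 8.
  rewrite [leqLHS]big_mkcond [X in _ <= X + _]big_mkcond /=.
  rewrite [leqLHS](bigD1 (Ordinal cutB)) // [X in _ <= X + _](bigD1 (Ordinal cutB)) //=.
  rewrite /starred ltnn !andbF add0n addnC.
  apply: leq_add.
    apply: leq_sum => y neq_y; have {}neq_y : y != cut x :> nat by [].
    by rewrite ltnS (leq_eqVlt y) (negbTE neq_y).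
  case: ifP => // /and3P[_ /andP[d0 _] _].
  by rewrite /threshold; apply: leq_div2l; lia.
have : 8 * (q %/ 8) <= q by rewrite mulnC leq_divM.
move: (\sum_(y < B | star x y) thr y) over => S over q8 le.
have : q <= 8 * S by lia.
move: low_le; move: (\sum_(_ < B | _) 1) => c; nia.
Qed.

(** Each live edge is low in at least one of its two directions. *)
Lemma total_degree_le :
  \sum_(x < B) d x <= 2 * \sum_(x < B) \sum_(y < B | a x y && low d x y) 1.
Proof.
set L := (X in 2 * X).
have -> : 2 * L = L + \sum_(x < B) \sum_(y < B | a x y && low d y x) 1.
  rewrite mul2n -addnn; congr (_ + _); rewrite /L.
  rewrite (exchange_big_dep xpredT) //=; apply: eq_bigr => y _.
  by apply: eq_bigl => x; rewrite a_sym.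
rewrite -big_split /=; apply: leq_sum => x _.
rewrite {1}d_def /live_degree; case lx: (live x) => //; rewrite mul1n.
rewrite big_mkcond [X in _ <= X + _]big_mkcond [X in _ <= _ + X]big_mkcond -big_split /=.
apply: leq_sum => y _; case: ifP => //= axy; case ly: (live y) => //=.
have dx : 0 < d x by apply: (live_gt0 (ltn_ord y)).
have dy : 0 < d y by apply: (live_gt0 (ltn_ord x)); rewrite 1?a_sym.
by rewrite /low dx dy /=; case: (leqP (d y) (d x)) => // /ltnW ->.
Qed.

(** The left-hand side is organised around the node to be removed, the right-hand
    side around the neighbour that knows [G]. *)
Lemma weighted_star_exchange (G : nat -> nat) :
  \sum_(v < B) d v * \sum_(u < B | star v u) G u =
  \sum_(u < B) weight B d cut u (a u) * G u.
Proof.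
under eq_bigr => v _ do rewrite big_distrr /=.
rewrite (exchange_big_dep xpredT) //=; apply: eq_bigr => u _.
rewrite /weight big_distrl /=; apply: eq_bigl => v.
by rewrite /starred a_sym.
Qed.

(** If some marked starred neighbour has no conflict, it joins and pays for itself, and its pairs
    with the other marked ones pay for them. Otherwise every marked one has a conflict to pay for
    it. *)
Lemma star_marked_le s (v : 'I_B) :
  \sum_(u < B | star v u) mk s u <=
  [exists u : 'I_B, a v u && joins B q h d s u (a u)]
  + (\sum_(u < B | star v u) mk s u * conflicts B q h d s u (a u)
     + \sum_(u < B | star v u)
         \sum_(w < B | star v w && (val w != val u)) mk s u * mk s w).
Proof.
have [no|] := boolP [forall u : 'I_B, star v u ==>
    (mk s u <= mk s u * conflicts B q h d s u (a u))].
  apply: leq_trans (leq_addl _ _); apply: leq_trans (leq_addr _ _).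
  by apply: leq_sum => u su; move/forallP: no => /(_ u); rewrite su.
rewrite negb_forall => /existsP[u0]; rewrite negb_imply -ltnNge => /andP[su0].
case mu0: (marked _ _ _ s u0) => //; rewrite mul1n ltnS leqn0 => conf0.
have -> : [exists u : 'I_B, a v u && joins B q h d s u (a u)].
  apply/existsP; exists u0; rewrite /joins mu0 conf0 !andbT.
  by case/and3P: su0.
rewrite (bigD1 u0) //= mu0 leq_add2l; apply: leq_trans (leq_addl _ _).
rewrite [leqRHS](bigD1 u0) //=; apply: leq_trans (leq_addr _ _).
by under [leqRHS]eq_bigr => w _ do rewrite mu0 mul1n.
Qed.

Lemma gain_le s :
  \sum_(x < B) gain B q h d cut s x (a x) <=
  \sum_(x < B | [exists u : 'I_B, a x u && joins B q h d s u (a u)]) d x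
  + \sum_(x < B) loss B q h d cut s x (a x).
Proof.
rewrite /gain -(weighted_star_exchange (fun u => mk s u)).
rewrite /loss big_split /=.
rewrite -(weighted_star_exchange (fun u => mk s u * conflicts B q h d s u (a u))).
rewrite -big_split [X in X + _]big_mkcond /= -big_split /=.
apply: leq_sum => v _; rewrite -mulnDr.
apply: leq_trans (leq_mul (leqnn _) (star_marked_le s v)) _.
by rewrite mulnDr leq_add2r; case: ifP; rewrite ?muln0 ?muln1.
Qed.

Local Notation S := (2 ^ (3 * k)).

Lemma sum_marked x : \sum_(0 <= s < S) mk s x = q ^ 2 * thr x.
Proof. exact/h_family.1/threshold_le. Qed.

Lemma sum_marked_pair (x y : 'I_B) : val x != val y ->
  \sum_(0 <= s < S) mk s x * mk s y <= q * (thr x * thr y) + D * (q * thr x).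
Proof.
by move=> neq; apply: h_family.2 => //; rewrite -?B_def ?threshold_le.
Qed.

Lemma sum_gain :
  \sum_(0 <= s < S) \sum_(x < B) gain B q h d cut s x (a x) =
  q ^ 2 * \sum_(x < B) d x * \sum_(y < B | star x y) thr y.
Proof.
rewrite exchange_big /= (weighted_star_exchange thr) big_distrr /=.
apply: eq_bigr => x _; rewrite /gain -big_distrr /= sum_marked; lia.
Qed.

Lemma sum_pair_bound (P : pred 'I_B) t :
  \sum_(y < B | P y) (q * (t * thr y) + D * (q * t)) =
  q * t * (\sum_(y < B | P y) thr y + D * \sum_(y < B | P y) 1).
Proof.
rewrite mulnDr !big_distrr -big_split /=; apply: eq_bigr => y _; lia.
Qed.

(** Hash collisions cost one extra eighth, because [D * c <= Delta * D <= q / 8]. *)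
Lemma pair_bound_le p t A c : 8 * A <= p * q -> c <= Delta ->
  8 * (q * t * (A + D * c)) <= p.+1 * (q ^ 2 * t).
Proof.
move=> Ap cD; have : D * c <= Delta * D by rewrite mulnC leq_mul2r cD orbT.
move=> Dc; have : 8 * (A + D * c) <= p.+1 * q by rewrite mulSn; lia.
move=> le; have -> : 8 * (q * t * (A + D * c)) = q * t * (8 * (A + D * c)) by lia.
have -> : p.+1 * (q ^ 2 * t) = q * t * (p.+1 * q) by rewrite -mulnn; lia.
by rewrite leq_mul2l le orbT.
Qed.

(** For [d x > 0], at most [d x] neighbours have degree at least [d x], each with threshold at most
    [q / (8 * d x)]: one eighth in all, and collisions add another. *)
Lemma sum_conflicts (x : 'I_B) :
  4 * \sum_(0 <= s < S) mk s x * conflicts B q h d s x (a x) <= q ^ 2 * thr x.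
Proof.
rewrite /conflicts.
under eq_bigr => s _ do rewrite big_distrr /=.
rewrite exchange_big /=.
have [dx0|dx0] := posnP (d x).
  rewrite big1 ?muln0 // => y _; apply: big1 => s _.
  by rewrite /marked /threshold dx0 muln0 divn0 ltn0.
pose H (y : 'I_B) := a x y && (d x <= d y).
have cardH : \sum_(y < B | H y) 1 <= d x.
  rewrite d_def /live_degree; move: (dx0); rewrite {1}d_def /live_degree.
  case: (live x) => // _; rewrite mul1n [leqRHS]big_mkcond [leqLHS]big_mkcond.
  apply: leq_sum => y _; rewrite /H; case: (a x y) => //=.
  case ly: (live y) => //; case: ifP => //.
  by rewrite leqNgt [d y]d_def /live_degree ly dx0.
have sumH : 8 * \sum_(y < B | H y) thr y <= q.
  rewrite -(leq_pmul2l dx0) mulnCA big_distrr /= big_distrr /=.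
  apply: leq_trans (_ : \sum_(y < B | H y) q <= _).
    apply: leq_sum => y /andP[_ dxy]; apply: leq_trans (degree_threshold_le y).
    by rewrite mulnA leq_mul2r leq_mul2l dxy !orbT.
  by rewrite sum_nat_const -[#|_|]muln1 -sum_nat_const leq_mul2r cardH orbT.
apply: leq_trans (_ : 4 * (\sum_(y < B | H y)
    (q * (thr x * thr y) + D * (q * thr x))) <= _).
  rewrite leq_mul2l /=; apply: leq_sum => y /andP[axy _].
  apply: sum_marked_pair; apply: contraTneq axy => <-; exact: a_irr.
rewrite sum_pair_bound.
suff : 8 * (q * thr x * (\sum_(y < B | H y) thr y + D * \sum_(y < B | H y) 1))
    <= 2 * (q ^ 2 * thr x) by lia.
by apply: pair_bound_le; rewrite ?mul1n // (leq_trans cardH) ?degree_le.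
Qed.

(** The cutoff bounds the starred thresholds by [q / 4], which is two eighths; collisions add the
    third. *)
Lemma sum_star_pairs (x : 'I_B) :
  8 * \sum_(0 <= s < S) \sum_(u < B | star x u)
        \sum_(w < B | star x w && (val w != val u)) mk s u * mk s w
  <= 3 * (q ^ 2 * \sum_(y < B | star x y) thr y).
Proof.
rewrite exchange_big /= [in leqRHS]mulnA !big_distrr /=.
apply: leq_sum => u su; rewrite -mulnA.
rewrite exchange_big /=.
apply: leq_trans (_ : 8 * (\sum_(w < B | star x w)
    (q * (thr u * thr w) + D * (q * thr u))) <= _).
  rewrite leq_mul2l /= big_mkcondr /=; apply: leq_sum => w _.
  by case: ifP => // neq; apply: sum_marked_pair; rewrite eq_sym.
rewrite sum_pair_bound; apply: pair_bound_le.
  have := cutoff_sum_le x; lia.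
apply: leq_trans (a_deg x).
rewrite big_mkcond [leqRHS]big_mkcond; apply: leq_sum => w _.
by rewrite /starred; case: (a x w) => //=; case: ifP.
Qed.

Lemma seeds_average :
  S * \sum_(x < B) d x
  + 128 * \sum_(0 <= s < S) \sum_(x < B) loss B q h d cut s x (a x)
  <= 128 * \sum_(0 <= s < S) \sum_(x < B) gain B q h d cut s x (a x).
Proof.
(* [P] is the total gain. The loss is at most [2/8 + 3/8] of it, so [128 * 3/8 = 48] copies of [P]
   remain, and 32 suffice. *)
pose P := q ^ 2 * \sum_(x < B) d x * \sum_(y < B | star x y) thr y.
have S_q : S = q * q ^ 2 by rewrite -expnM -expnD; congr (2 ^ _); lia.
have le_deg : S * \sum_(x < B) d x <= 32 * P.
  have := total_degree_le.
  have : q * \sum_(x < B) \sum_(y < B | a x y && low d x y) 1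
      <= 16 * \sum_(x < B) d x * \sum_(y < B | star x y) thr y.
    rewrite !big_distrr /=; apply: leq_sum => x _.
    by rewrite mulnA; apply: cutoff_sum_ge.
  rewrite S_q /P; move: (\sum_(x < B) d x * _) => F.
  move: (\sum_(x < B) \sum_(y < B | _) 1) (\sum_(x < B) d x) => G E le1 le2.
  have : q * E <= 32 * F by nia.
  nia.
have le_loss : 8 * \sum_(0 <= s < S) \sum_(x < B) loss B q h d cut s x (a x) <= 5 * P.
  rewrite /loss; under eq_bigr do rewrite big_split /=.
  rewrite big_split /= mulnDr (_ : 5 * P = 2 * P + 3 * P); last by lia.
  apply: leq_add.
    rewrite /P (weighted_star_exchange thr) exchange_big /= !big_distrr /=.
    apply: leq_sum => x _; rewrite -big_distrr /=.
    have := sum_conflicts x; move: (\sum_(0 <= s < S) _) => F; nia.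
  rewrite exchange_big /= /P !big_distrr /=; apply: leq_sum => x _.
  rewrite -big_distrr /=; have := sum_star_pairs x.
  by move=> le; rewrite [8 * _]mulnCA [q ^ 2 * _]mulnCA [leqRHS]mulnCA leq_mul2l le orbT.
by rewrite sum_gain -/P; lia.
Qed.

(** The endpoint of smaller degree sees the mark of the other as a conflict; in a tie both do. *)
Lemma joins_independent s x y : x < B -> y < B -> a x y ->
  joins B q h d s x (a x) -> joins B q h d s y (a y) -> False.
Proof.
have no u w : w < B -> a u w -> d u <= d w ->
    joins B q h d s u (a u) -> joins B q h d s w (a w) -> False.
  move=> wB auw duw /andP[_ /eqP conf0] /andP[mw _]; move: conf0.
  by rewrite /conflicts (bigD1 (Ordinal wB)) /= ?auw ?duw ?mw.
move=> xB yB axy jx jy; case: (leqP (d x) (d y)) => [|/ltnW] le.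
  exact: (no x y).
by apply: (no y x) => //; rewrite a_sym.
Qed.

(** By [gain_le], nodes with a joining neighbour carry at least 1/128 of the total degree; they die,
    and no other degree grows. *)
Lemma live_degree_sum_decrease s (live' : nat -> bool) :
  \sum_(x < B) d x + 128 * \sum_(x < B) loss B q h d cut s x (a x)
    <= 128 * \sum_(x < B) gain B q h d cut s x (a x) ->
  (forall x, live' x -> live x) ->
  (forall x y, y < B -> a x y -> joins B q h d s y (a y) -> ~~ live' x) ->
  128 * \sum_(x < B) live_degree B live' x (a x) <= 127 * \sum_(x < B) d x.
Proof.
move=> good sub dead.
have split_deg : \sum_(x < B) d x =
    \sum_(x < B | [exists u : 'I_B, a x u && joins B q h d s u (a u)]) d x
    + \sum_(x < B | ~~ [exists u : 'I_B, a x u && joins B q h d s u (a u)]) d x.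
  by rewrite (bigID (fun x : 'I_B =>
    [exists u : 'I_B, a x u && joins B q h d s u (a u)])).
have rest : \sum_(x < B) live_degree B live' x (a x) <=
    \sum_(x < B | ~~ [exists u : 'I_B, a x u && joins B q h d s u (a u)]) d x.
  rewrite [leqRHS]big_mkcond; apply: leq_sum => x _; case: ifPn => [_|]; last first.
    rewrite negbK => /existsP[u /andP[axu ju]].
    by rewrite /live_degree (negbTE (dead _ _ (ltn_ord u) axu ju)).
  rewrite d_def /live_degree; apply: leq_mul; last apply: leq_sum => y _.
    by case l: (live' x) => //; rewrite (sub _ l).
  by case l: (live' y) => //; rewrite (sub _ l).
have gl := gain_le s; clear - good split_deg rest gl; lia.
Qed.

End LubyAnalysis.

(** * The protocol and its correctness *)

Arguments bind : simpl never.
Arguments broadcast : simpl never.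
Arguments spec : simpl never.

Definition total B f : protocol nat :=
  bind (broadcast f) (fun w => Ret (\sum_(x < B) w x)).

Arguments total : simpl never.

Fixpoint select_seed B (gn ls : nat -> nat -> (nat -> bool) -> nat) (E K lo : nat) :
    protocol nat :=
  if K is K'.+1 then
    bind (total B (fun x N => \sum_(lo <= s < lo + 2 ^ K') gn s x N)) (fun p =>
    bind (total B (fun x N => \sum_(lo <= s < lo + 2 ^ K') ls s x N)) (fun m =>
    select_seed B gn ls E K'
      (if 2 ^ K' * E + 128 * m <= 128 * p then lo else lo + 2 ^ K')))
  else Ret lo.

(** The state is the pair (live nodes, nodes that joined). *)
Definition luby_phase B k h (st : (nat -> bool) * (nat -> bool)) :
    protocol ((nat -> bool) * (nat -> bool)) :=
  bind (broadcast (live_degree B st.1)) (fun d =>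
  bind (broadcast (cutoff B (2 ^ k) d)) (fun cut =>
  bind (select_seed B (gain B (2 ^ k) h d cut) (loss B (2 ^ k) h d cut)
          (\sum_(x < B) d x) (3 * k) 0) (fun s =>
  bind (broadcast (fun x N => joins B (2 ^ k) h d s x N)) (fun J =>
  (* The public state does not contain the edges, so each node announces whether a neighbour
     joined. *)
  bind (broadcast (fun x N => 0 < \sum_(y < B | N y) J y)) (fun R =>
  Ret (fun x => [&& st.1 x, J x == 0 & R x == 0],
       fun x => st.2 x || (J x != 0))))))).

Fixpoint luby_phases B k h P st :=
  if P is P'.+1 then bind (luby_phase B k h st) (luby_phases B k h P')
  else Ret st.

Definition neighbours B (N : nat -> bool) : seq nat := [seq y <- iota 0 B | N y].

(** Identifiers are sent shifted by one, as 0 means that there is no [j]-th neighbour. *)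
Fixpoint gather B T j (acc : nat -> seq nat) : protocol (nat -> seq nat) :=
  if T is T'.+1 then
    bind (broadcast (fun x N => nth 0 (map S (neighbours B N)) j)) (fun w =>
    gather B T' j.+1 (fun x => rcons (acc x) (w x)))
  else Ret acc.

Definition independentb B (r : nat -> nat -> bool) (I : {set 'I_B}) : bool :=
  [forall x in I, forall y in I, ~~ r x y].

(** Maximum cardinality implies maximality, and [arg max] is a canonical choice on which all nodes
    agree. *)
Definition local_mis B (r : nat -> nat -> bool) : nat -> bool :=
  fun x => [exists z : 'I_B, (val z == x) &&
    (z \in [arg max_(I > set0 | independentb r I) #|I|])].

(** One logarithm pays for [Delta], one for [L <= Delta], [c] bits for the factor [c] and 3 bits for
    the factor 8 in [seed_bits_large]. *)
Definition seed_bits c Delta := 2 * (trunc_log 2 Delta).+1 + c + 3.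

Definition mis_protocol c n : protocol (nat -> bool) :=
  let L := (trunc_log 2 n).+1 in
  let B := 2 ^ (c * L) in
  bind (broadcast (fun x N => \sum_(y < B) N y)) (fun deg =>
  let Delta := \max_(x < B) deg x in
  if Delta < L then
    bind (gather B Delta 0 (fun=> [::])) (fun acc =>
    Ret (local_mis B (fun x y => y.+1 \in acc x)))
  else
    let k := seed_bits c Delta in
    let h := sval (hash_family_exists k (c * L)) in
    bind (luby_phases B k h (127 * (2 * (c * L)).+1) (xpredT, xpred0)) (fun st =>
    Ret (fun x => st.2 x || st.1 x))).

(** With [p = 127]: 127 phases, each keeping at most 127/128 of the live edges,
    halve their number. *)
Lemma double_expn_le p : 0 < p -> 2 * p ^ p <= p.+1 ^ p.
Proof.
case: p => // p _.
(* Bernoulli's inequality without denominators; at [m = p] both terms on the left coincide. *)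
have bernoulli m : p.+1 ^ m.+1 + m.+1 * p.+1 ^ m <= p.+2 ^ m.+1.
  elim: m => [|m IH]; first by rewrite !expn1 expn0; lia.
  rewrite expnS [leqRHS]expnS; move: IH; rewrite !(expnS _ m).
  move: (p.+1 ^ m) (p.+2 ^ m) => u v; nia.
by have := bernoulli p; rewrite -expnS addnn mul2n.
Qed.

(** * Correctness of the rounds, the phases and the local computation *)

Section Correctness.
Variables (n : nat) (e : rel 'I_n) (id : 'I_n -> nat) (M D : nat).
Hypothesis e_graph : simple_graph e.
Hypothesis id_inj : injective id.
Local Notation B := (2 ^ D).
Hypothesis id_lt : forall v, id v < B.
Local Notation a := (adj e id).
Local Notation spec p := (spec e id M p).

Lemma adj_sym x y : a x y = a y x.
Proof.
by apply/adjP/adjP => // [] [u [v [-> -> euv]]]; exists v, u; rewrite e_graph.1.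
Qed.

Lemma adj_irr x : ~~ a x x.
Proof.
apply/adjP => // [] [u [v [-> /id_inj<-]]].
by apply/negP/(e_graph.2 u).
Qed.

Lemma adj_lt x y : a x y -> y < B.
Proof. by case/adjP=> // u [v [_ -> _]]. Qed.

(** Stated for all naturals below [B]; those that are no identifier are isolated and must belong to
    the set. *)
Definition is_mis (r : nat -> bool) : Prop :=
  (forall x y, a x y -> r x -> r y -> False) /\
  (forall x, x < B -> ~~ r x -> exists2 y, r y & a x y).

Lemma is_mis_maximal r : is_mis r ->
  maximal_independent_set e [set v | r (id v)].
Proof.
case=> indep dom; split=> [u v|v].
  rewrite !inE => ru rv; apply/negP => euv.
  by apply: (indep (id u) (id v)) => //; rewrite adj_idE.
rewrite inE => /(dom _ (id_lt v))[y ry /adjP[] // u [w [/id_inj-> yw euw]]].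
by exists w; rewrite ?inE -?yw.
Qed.

Lemma spec_total f :
  (forall x, f x (a x) < M) -> (forall x, a x =1 xpred0 -> f x (a x) = 0) ->
  spec (total B f) 1 (fun t => t = \sum_(x < B) f x (a x)).
Proof.
move=> fM f0; rewrite -[1]addn0.
apply: spec_bind (spec_broadcast id_inj fM f0) _ => w wE; apply: spec_Ret.
by apply: eq_bigr => x _.
Qed.

Section SeedSelection.
Variables (gn ls : nat -> nat -> (nat -> bool) -> nat) (W E : nat).
Hypothesis gn_le : forall s x, gn s x (a x) <= W.
Hypothesis ls_le : forall s x, ls s x (a x) <= W.
Hypothesis gn0 : forall s x, a x =1 xpred0 -> gn s x (a x) = 0.
Hypothesis ls0 : forall s x, a x =1 xpred0 -> ls s x (a x) = 0.

Lemma sum_seeds_lt (g : nat -> nat -> (nat -> bool) -> nat) K lo x :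
  (forall s x, g s x (a x) <= W) -> 2 ^ K.+1 * W < M ->
  \sum_(lo <= s < lo + 2 ^ K) g s x (a x) < M.
Proof.
move=> gW; apply: leq_ltn_trans.
apply: leq_trans (_ : \sum_(lo <= s < lo + 2 ^ K) W <= _); first exact: leq_sum.
rewrite sum_nat_const_nat addKn expnS; lia.
Qed.

(* Bisection: whenever the first half of the current seed interval fails the
   averaged inequality, the second half satisfies it. *)
Lemma spec_select_seed K lo : 2 ^ K * W < M ->
  2 ^ K * E + 128 * \sum_(lo <= s < lo + 2 ^ K) \sum_(x < B) ls s x (a x)
    <= 128 * \sum_(lo <= s < lo + 2 ^ K) \sum_(x < B) gn s x (a x) ->
  spec (select_seed B gn ls E K lo) (2 * K) (fun s =>
    E + 128 * \sum_(x < B) ls s x (a x) <= 128 * \sum_(x < B) gn s x (a x)).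
Proof.
elim: K lo => [|K IH] lo WM.
  by move=> avg; apply: spec_Ret; move: avg; rewrite !mul1n !addn1 !big_nat1.
have WM' : 2 ^ K * W < M by apply: leq_ltn_trans WM; rewrite expnS; lia.
move=> avg; rewrite mulnS -[2 + _]/(1 + (1 + 2 * K)) [select_seed _ _ _ _ _ _]/=.
eapply spec_bind; [apply: spec_total => [x|x ax0]|move=> p ->].
- exact: sum_seeds_lt.
- by apply: big1 => s _; apply: gn0.
eapply spec_bind; [apply: spec_total => [x|x ax0]|move=> m ->].
- exact: sum_seeds_lt.
- by apply: big1 => s _; apply: ls0.
rewrite [X in _ + 128 * X <= _]exchange_big [X in _ <= 128 * X]exchange_big /=.
move: avg; rewrite expnS mul2n -addnn addnA.
rewrite !(big_cat_nat (m := lo) (n := lo + 2 ^ K) (p := lo + 2 ^ K + 2 ^ K)) ?leq_addr //=.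
case: ifPn => [first _|]; first exact: IH.
rewrite -ltnNge => fail avg; apply: IH => //.
move: fail avg; rewrite mulnDl /=.
move: (\sum_(lo <= s < lo + 2 ^ K) \sum_(x < B) ls s x (a x)) => l1.
move: (\sum_(lo <= s < lo + 2 ^ K) \sum_(x < B) gn s x (a x)) => g1.
move: (\sum_(lo + 2 ^ K <= s < _) \sum_(x < B) ls s x (a x)) => l2.
move: (\sum_(lo + 2 ^ K <= s < _) \sum_(x < B) gn s x (a x)) => g2.
lia.
Qed.

End SeedSelection.

Section Phase.
Variables (k Delta : nat) (h : nat -> nat -> nat).
Local Notation q := (2 ^ k).
Hypothesis h_family : hash_family k D h.
Hypothesis a_deg : forall x, \sum_(y < B | a x y) 1 <= Delta.
Hypothesis q_large : 8 * (Delta * D) <= q.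
Hypothesis q_deg : 8 * Delta <= q.
Hypothesis M_large : 2 ^ (3 * k) * (2 * B ^ 3) < M.

Lemma bits_lt_M m : m <= B -> m < M.
Proof.
move=> mB; apply: leq_ltn_trans M_large; apply: leq_trans mB _.
have : 0 < B by rewrite expn_gt0.
have : 0 < 2 ^ (3 * k) by rewrite expn_gt0.
rewrite !expnS expn0; nia.
Qed.

Definition luby_invariant (st : (nat -> bool) * (nat -> bool)) : Prop :=
  [/\ forall x y, a x y -> st.2 x -> st.2 y -> False,
      forall x y, a x y -> st.2 x -> ~~ st.1 y &
      forall x, x < B -> ~~ st.1 x -> st.2 x \/ exists2 y, st.2 y & a x y].

Definition live_edges (live : nat -> bool) : nat :=
  \sum_(x < B) live_degree B live x (a x).

Lemma sum_pred_le (P : pred 'I_B) F m : (forall i, F i <= m) ->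
  \sum_(i < B | P i) F i <= B * m.
Proof.
move=> Fm; apply: leq_trans (_ : \sum_(i < B) m <= _).
  by rewrite big_mkcond; apply: leq_sum => i _; case: ifP.
by rewrite sum_nat_const card_ord.
Qed.

Lemma live_degree_le live x : live_degree B live x (a x) <= B.
Proof.
rewrite /live_degree -[leqRHS]mul1n; apply: leq_mul; first exact: leq_b1.
by rewrite -[leqRHS]muln1; apply: sum_pred_le => i; apply: leq_b1.
Qed.

Lemma spec_luby_phase st : luby_invariant st ->
  spec (luby_phase B k h st) (6 * k + 4) (fun st' =>
    luby_invariant st' /\ 128 * live_edges st'.1 <= 127 * live_edges st.1).
Proof.
case: st => live I inv; rewrite /luby_phase /=.
(* Two broadcasts for each of the [3 * k] seed bits, and four for degrees, cutoffs, joins and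
   removals. *)
have -> : 6 * k + 4 = 1 + (1 + (2 * (3 * k) + (1 + (1 + 0)))) by lia.
eapply spec_bind; [apply: (spec_broadcast id_inj) => [x|x ax0]|move=> d dE].
- exact/bits_lt_M/live_degree_le.
- by rewrite /live_degree big_pred0 ?muln0.
have d_le x : d x <= B by rewrite dE live_degree_le.
have d0 x : a x =1 xpred0 -> d x = 0.
  by move=> ax0; rewrite dE /live_degree big_pred0 ?muln0.
have has0 x : a x =1 xpred0 -> has (a x) (iota 0 B) = false.
  by move=> ax0; rewrite (eq_has ax0) has_pred0.
eapply spec_bind; [apply: (spec_broadcast id_inj) => [x|x ax0]|move=> cut cutE].
- apply: bits_lt_M; rewrite /cutoff; case: ifP => // _.
  by apply/bigmax_leqP => i _; rewrite -ltnS.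
- by rewrite /cutoff has0.
have weight0 x : a x =1 xpred0 -> weight B d cut x (a x) = 0.
  by move=> ax0; apply: big_pred0 => y; rewrite ax0.
have weight_le x : weight B d cut x (a x) <= B * B by apply: sum_pred_le.
(* [gain] is at most [B ^ 2], and each of the two terms of [loss] at most [B ^ 3]. *)
eapply spec_bind; [apply: (@spec_select_seed _ _ (2 * B ^ 3)) | ].
- move=> s x; rewrite /gain; have := weight_le x.
  have : 0 < B by rewrite expn_gt0.
  by rewrite !expnS expn0; case: marked; nia.
- move=> s x; rewrite /loss mul2n -addnn; apply: leq_add; rewrite !expnS expn0 muln1.
    rewrite [leqRHS]mulnA; apply: leq_mul => //.
    rewrite -[leqRHS]mul1n; apply: leq_mul; first exact: leq_b1.
    by rewrite -[leqRHS]muln1; apply: sum_pred_le => i; apply: leq_b1.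
  apply: leq_mul => //; apply: sum_pred_le => u.
  rewrite -[leqRHS]muln1; apply: sum_pred_le => w.
  by rewrite mulnb leq_b1.
- by move=> s x ax0; rewrite /gain weight0.
- move=> s x ax0; rewrite /loss weight0 // d0 //.
- exact: M_large.
- rewrite add0n; exact: (seeds_average (erefl _) h_family adj_sym adj_irr a_deg
    q_large q_deg dE cutE).
move=> s good.
eapply spec_bind; [apply: (spec_broadcast id_inj) => [x|x ax0]|move=> J JE].
- by apply: bits_lt_M; rewrite (leq_trans (leq_b1 _)) ?expn_gt0.
- by rewrite /joins /marked /threshold d0 // muln0 divn0 ltn0.
eapply spec_bind; [apply: (spec_broadcast id_inj) => [x|x ax0]|move=> R RE].
- by apply: bits_lt_M; rewrite (leq_trans (leq_b1 _)) ?expn_gt0.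
- by rewrite big_pred0.
have J_joins x : (J x != 0) = joins B q h d s x (a x).
  by rewrite JE; case: joins.
have J_live x : J x != 0 -> live x.
  rewrite J_joins /joins /marked /threshold; apply: contraTT => nl.
  by rewrite dE /live_degree (negbTE nl) muln0 divn0 ltn0.
have R_P x : R x != 0 -> exists2 y, J y != 0 & a x y.
  rewrite RE eqb0 negbK lt0n sum_nat_eq0 negb_forall => /existsP[y].
  by rewrite negb_imply => /andP[axy Jy]; exists y.
have R_I x y : a x y -> J y != 0 -> R x != 0.
  move=> axy Jy; rewrite RE eqb0 negbK (bigD1 (Ordinal (adj_lt axy))) //=.
  by rewrite addn_gt0 lt0n Jy.
apply: spec_Ret; case: inv => [/= ind sep dom]; split; last first.
  rewrite /= /live_edges; under [X in _ <= _ * X]eq_bigr => x _ do rewrite -dE.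
  apply: (live_degree_sum_decrease adj_sym dE good) => [x /and3P[]|x y _ axy jy] //.
  by rewrite !negb_and (R_I x y axy) ?orbT // J_joins.
split=> /= [x y axy|x y axy|x xB].
- case/orP=> [Ix|Jx] /orP[Iy|Jy].
  + exact: ind axy Ix Iy.
  + by have /negP[] := sep _ _ axy Ix; apply: J_live.
  + by rewrite adj_sym in axy; have /negP[] := sep _ _ axy Iy; apply: J_live.
  rewrite !J_joins in Jx Jy.
  have xB : x < B by apply: (@adj_lt y); rewrite adj_sym.
  exact: (joins_independent adj_sym xB (adj_lt axy) axy Jx Jy).
- case/orP=> [Ix|Jx]; first by rewrite (negbTE (sep _ _ axy Ix)).
  by rewrite !negb_and (R_I y x) ?orbT // adj_sym.
rewrite !negb_and => /or3P[nl|Jx|/R_P[y Jy axy]].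
- case: (dom x xB nl) => [->|[y Iy axy]]; first by left.
  by right; exists y; rewrite ?Iy.
- by left; rewrite Jx orbT.
by right; exists y; rewrite ?Jy ?orbT.
Qed.

Lemma spec_luby_phases P st : luby_invariant st ->
  spec (luby_phases B k h P st) (P * (6 * k + 4)) (fun st' =>
    luby_invariant st' /\ 128 ^ P * live_edges st'.1 <= 127 ^ P * live_edges st.1).
Proof.
elim: P st => [|P IH] st inv; first by apply: spec_Ret; rewrite !mul1n.
rewrite mulSn /=; apply: spec_bind (spec_luby_phase inv) _ => st1 [inv1 le1].
apply: spec_weaken (IH _ inv1) => // st2 [inv2 le2]; split=> //.
rewrite !expnS; move: le1 le2; nia.
Qed.

Lemma live_edges0_mis st : luby_invariant st -> live_edges st.1 = 0 ->
  is_mis (fun x => st.2 x || st.1 x).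
Proof.
case: st => live I [/= ind sep dom] E0; split=> [x y axy|x xB].
  have xB : x < B by apply: (@adj_lt y); rewrite adj_sym.
  case/orP=> [Ix|lx] /orP[Iy|ly].
  - exact: ind axy Ix Iy.
  - by have /negP := sep _ _ axy Ix.
  - by rewrite adj_sym in axy; have /negP := sep _ _ axy Iy.
  move: E0; rewrite /live_edges (bigD1 (Ordinal xB)) //= /live_degree lx mul1n.
  by rewrite (bigD1 (Ordinal (adj_lt axy))) //= ly.
rewrite negb_or => /andP[nIx /(dom x xB)[Ix|[y Iy axy]]]; first by rewrite Ix in nIx.
by exists y; rewrite ?Iy.
Qed.

Lemma spec_luby st m : luby_invariant st -> live_edges st.1 < 2 ^ m ->
  spec (luby_phases B k h (127 * m) st) (127 * m * (6 * k + 4)) (fun st' =>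
    is_mis (fun x => st'.2 x || st'.1 x)).
Proof.
move=> inv E_lt; apply: spec_weaken (spec_luby_phases _ inv) => // st' [inv' le].
apply: live_edges0_mis => //; move: le (double_expn_le (isT : 0 < 127)).
rewrite !expnM; have : 0 < 127 ^ 127 by rewrite expn_gt0.
move: (128 ^ 127) (127 ^ 127) (live_edges st'.1) => u v E' v0 le uv.
(* Cancelling [v ^ m] gives [2 ^ m * E' <= live_edges st.1 < 2 ^ m], hence [E' = 0]. *)
have : (2 * v) ^ m * E' <= v ^ m * live_edges st.1.
  apply: leq_trans le; rewrite leq_mul2r; apply/orP; right.
  by case: (m) => // m'; rewrite leq_exp2r.
rewrite expnMn [2 ^ m * _]mulnC -mulnA leq_pmul2l ?expn_gt0 ?v0 // => le'.
case: E' {le} le' => // E' le'; move: E_lt le'; nia.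
Qed.

End Phase.

Lemma spec_gather T j acc : B < M ->
  spec (gather B T j acc) T (fun r => forall x,
    r x = acc x ++ [seq nth 0 (map S (neighbours B (a x))) i | i <- iota j T]).
Proof.
move=> BM; elim: T j acc => [|T IH] j acc.
  by move=> x; rewrite cats0.
rewrite -[T.+1]/(1 + T) [gather _ _ _ _]/=.
eapply spec_bind; [apply: (spec_broadcast id_inj) => [x|x ax0]|move=> w wE].
- have [lt|ge] := ltnP j (size (neighbours B (a x))).
    rewrite (nth_map 0) //; apply: leq_ltn_trans BM.
    by have := mem_nth 0 lt; rewrite mem_filter => /andP[/adj_lt].
  by rewrite nth_default ?size_map //; apply: leq_ltn_trans BM.
- by rewrite /neighbours (eq_filter ax0) filter_pred0 nth_nil.
apply: spec_weaken (IH _ _) => // r rE x.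
by rewrite rE wE cat_rcons.
Qed.

Lemma gathered_neighbours Delta x y : \sum_(z < B | a x z) 1 <= Delta ->
  (y.+1 \in [seq nth 0 (map S (neighbours B (a x))) i | i <- iota 0 Delta]) = a x y.
Proof.
move=> degx; have size_le : size (neighbours B (a x)) <= Delta.
  rewrite size_filter -sum1_count; apply: leq_trans degx.
  by rewrite -(big_mkord (a x) (fun=> 1)) /index_iota subn0.
apply/mapP/idP => [[i _ yi]|axy].
  have i_lt : i < size (neighbours B (a x)).
    by rewrite ltnNge; apply/negP => ge; rewrite nth_default ?size_map in yi.
  move: yi; rewrite (nth_map 0) // => -[->].
  by have := mem_nth 0 i_lt; rewrite mem_filter => /andP[].
have y_in : y \in neighbours B (a x).
  by rewrite mem_filter axy mem_iota (adj_lt axy).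
exists (index y (neighbours B (a x))).
  by rewrite mem_iota (leq_trans _ size_le) // index_mem.
by rewrite (nth_map 0) ?index_mem // nth_index.
Qed.

Lemma local_mis_correct (r : nat -> nat -> bool) :
  (forall x y, r x y = a x y) -> is_mis (local_mis B r).
Proof.
move=> rE; rewrite /local_mis; case: arg_maxnP => [|I indI maxI].
  by apply/forall_inP => x; rewrite inE.
have memI (x : 'I_B) : [exists z : 'I_B, (val z == val x) && (z \in I)] = (x \in I).
  apply/existsP/idP => [[z /andP[/eqP/val_inj->]] //|xI].
  by exists x; rewrite eqxx.
split=> [x y axy|x xB].
  move=> /existsP[u /andP[/eqP ux uI]] /existsP[w /andP[/eqP wy wI]].
  move/forall_inP: indI => /(_ u uI)/forall_inP/(_ w wI).
  by rewrite rE ux wy axy.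
rewrite (memI (Ordinal xB)) => xI.
suff /existsP[y /andP[yI axy]] : [exists y : 'I_B, (y \in I) && a x y].
  by exists y; rewrite ?memI.
apply: contraT; rewrite negb_exists => /forallP no_nbr.
suff /maxI : independentb r (Ordinal xB |: I) by rewrite /= cardsU1 xI add1n ltnn.
apply/forall_inP => u /setU1P u_in; apply/forall_inP => w /setU1P w_in.
rewrite rE; case: u_in w_in => [->|uI] [->|wI] //=.
- exact: adj_irr.
- by have := no_nbr w; rewrite wI.
- by have := no_nbr u; rewrite uI adj_sym.
by move/forall_inP: indI => /(_ u uI)/forall_inP/(_ w wI); rewrite rE.
Qed.

Definition public_degree x := \sum_(y < B) a x y.

Lemma public_degreeE x : public_degree x = \sum_(y < B | a x y) 1.
Proof. by rewrite big_mkcond. Qed.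

Lemma public_degree_id v : public_degree (id v) = #|[set u | e v u]|.
Proof.
pose oid u := Ordinal (id_lt u).
have oid_inj : injective oid by move=> u w /(congr1 val)/id_inj.
rewrite public_degreeE sum1_card -(card_imset _ oid_inj); apply: eq_card => y.
rewrite [LHS]unfold_in; apply/adjP/imsetP => // [[u [w [/id_inj<- yw evw]]]|[w]].
  by exists w; [rewrite inE | apply: val_inj].
by rewrite inE => evw ->; exists v, w.
Qed.

Lemma public_max_degree : \max_(x < B) public_degree x = max_degree e.
Proof.
apply/eqP; rewrite /max_degree eqn_leq; apply/andP; split.
  apply/bigmax_leqP => x _; have [v /eqP <-|no] := pickP (fun v => id v == x).
    by rewrite public_degree_id (leq_bigmax v).
  rewrite public_degreeE big_pred0 // => y; apply/adjP => // [[u [w [xu _ _]]]].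
  by have := no u; rewrite xu eqxx.
apply/bigmax_leqP => v _; rewrite -public_degree_id.
exact: (@leq_bigmax _ (fun x : 'I_B => public_degree x) (Ordinal (id_lt v))).
Qed.

Lemma degree_le_max x : \sum_(y < B | a x y) 1 <= max_degree e.
Proof.
rewrite -public_degreeE -public_max_degree.
have [xB|xB] := ltnP x B.
  exact: (@leq_bigmax _ (fun x : 'I_B => public_degree x) (Ordinal xB)).
rewrite public_degreeE big_pred0 // => y; apply: contraTF xB.
by rewrite adj_sym -ltnNge => /adj_lt.
Qed.

End Correctness.

(** * Choice of parameters and total cost *)

Lemma seed_bits_large c Delta L : L <= Delta ->
  8 * (Delta * (c * L)) <= 2 ^ seed_bits c Delta /\
  8 * Delta <= 2 ^ seed_bits c Delta.
Proof.
move=> LD; have lt := trunc_log_ltn Delta (isT : 1 < 2).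
have -> : 2 ^ seed_bits c Delta =
    8 * (2 ^ (trunc_log 2 Delta).+1 * (2 ^ c * 2 ^ (trunc_log 2 Delta).+1)).
  rewrite -!expnD -[8]/(2 ^ 3) -expnD; congr (2 ^ _); rewrite /seed_bits; lia.
have c2 : c <= 2 ^ c by rewrite ltnW // ltn_expl.
have c0 : 0 < 2 ^ c by rewrite expn_gt0.
split; rewrite leq_mul2l /=.
  apply: leq_mul; first exact: ltnW.
  by apply: leq_mul => //; apply: leq_trans LD (ltnW lt).
rewrite -[leqLHS]muln1; apply: leq_mul; first exact: ltnW.
by rewrite muln_gt0 c0 expn_gt0.
Qed.

Lemma round_count p c L l : 0 < L -> 0 < l ->
  L + p * (2 * (c * L)).+1 * (6 * (2 * l + c + 3) + 4)
    <= (1 + p * (2 * c + 1) * (6 * (c + 5) + 4)) * l * L.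
Proof.
move=> L0 l0; have phases : (2 * (c * L)).+1 <= (2 * c + 1) * L by nia.
have bits : 6 * (2 * l + c + 3) + 4 <= (6 * (c + 5) + 4) * l by nia.
have := leq_mul (leq_mul (leqnn p) phases) bits; nia.
Qed.

Lemma spec_mis_protocol c n (e : rel 'I_n) (id : 'I_n -> nat) :
  simple_graph e -> injective id ->
  (forall v, id v < 2 ^ (c * (trunc_log 2 n).+1)) ->
  spec e id (2 ^ ((12 * c + 17) * (trunc_log 2 n).+1)) (mis_protocol c n)
    ((1 + 127 * (2 * c + 1) * (6 * (c + 5) + 4)) * (trunc_log 2 (max_degree e)).+1
       * (trunc_log 2 n).+1)
    (fun r => maximal_independent_set e [set v | r (id v)]).
Proof.
move=> graph_e id_inj id_lt; rewrite /mis_protocol.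
move: ((trunc_log 2 n).+1) (ltn0Sn (trunc_log 2 n)) id_lt => L L_gt0 id_lt.
(* A seed sum needs [3 * k + 3 * c * L + 1] bits, and [k <= (3 * c + 5) * L]; this stays below
   [(12 * c + 17) * L]. *)
set M := 2 ^ (_ * L); set lD := (trunc_log 2 (max_degree e)).+1.
have max_le : max_degree e <= 2 ^ (c * L).
  rewrite -(public_max_degree e id_inj id_lt); apply/bigmax_leqP => x _.
  by rewrite public_degreeE -[leqRHS]muln1 sum_pred_le.
have BM : 2 ^ (c * L) < M by rewrite ltn_exp2l; nia.
(* The summand [L] pays for the degree round and, when [Delta < L], for the [Delta] gathering rounds
   as well. *)
apply: (@spec_weaken _ _ _ _ _ _
  (1 + (L + 127 * (2 * (c * L)).+1 * (6 * seed_bits c (max_degree e) + 4)).-1)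
  _ (fun r => is_mis e id (c * L) r)) => [|r|].
- apply: leq_trans (round_count _ _ _ _) => //.
  rewrite /seed_bits -/lD; lia.
- exact: is_mis_maximal.
eapply spec_bind; [apply: (spec_broadcast id_inj) => [x|x ax0]|move=> deg degE].
- apply: leq_ltn_trans BM; rewrite -[leqRHS]muln1 sum_pred_le // => y; exact: leq_b1.
- by apply: big1 => y _; rewrite ax0.
have -> : \max_(x < 2 ^ (c * L)) deg x = max_degree e.
  rewrite -(public_max_degree e id_inj id_lt); apply: eq_bigr => x _; exact: degE.
have adeg := degree_le_max graph_e id_inj id_lt.
case: ltnP => [DL|LD].
  apply: (@spec_weaken _ _ _ _ _ _ (max_degree e + 0) _ _ _ _ (fun r Hr => Hr)).
    lia.
  eapply spec_bind; [exact: spec_gather|move=> acc accE].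
  apply: spec_Ret; apply: local_mis_correct => // x y.
  by rewrite accE gathered_neighbours.
set k := seed_bits _ _; set h := sval _.
have hP : 0 < k -> hash_family k (c * L) h
  by exact: (svalP (hash_family_exists k (c * L))).
have [q_large q_deg] := seed_bits_large c LD.
have k_le : k <= (3 * c + 5) * L.
  have : trunc_log 2 (max_degree e) <= c * L.
    by rewrite -(trunc_expnK (c * L) (isT : 1 < 2)) leq_trunc_log.
  rewrite /k /seed_bits; nia.
apply: (@spec_weaken _ _ _ _ _ _ (127 * (2 * (c * L)).+1 * (6 * k + 4) + 0)
  _ _ _ _ (fun r Hr => Hr)).
  lia.
eapply spec_bind; last by move=> st Hst; apply: spec_Ret; exact: Hst.
apply: (spec_luby graph_e id_inj id_lt _ adeg q_large q_deg) => //.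
- by apply: hP; rewrite /k /seed_bits; lia.
- rewrite -!expnM -expnS -expnD ltn_exp2l //; nia.
(* The trivial bound [B * B] on the initial degree sum explains the exponent [2 * (c * L) + 1] in
   the number of phases. *)
apply: (@leq_ltn_trans (2 ^ (c * L) * 2 ^ (c * L))).
  by apply: sum_pred_le => x; apply: live_degree_le.
by rewrite -expnD addnn -mul2n ltn_exp2l.
Qed.

(* For every constant c (identifiers have at most c * (log2 n + 1) bits)
   there is a deterministic algorithm A, a constant b (message size
   b * (log2 n + 1) bits) and a constant C such that on every n-node simple
   graph with any unique identifiers, A computes an MIS within
   C * (log2 Delta + 1) * (log2 n + 1) rounds. *)
Theorem theorem2 :
  forall c : nat, exists (A : bcc_algorithm) (b C : nat),
    forall (n : nat) (e : rel 'I_n) (id : 'I_n -> nat),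
      simple_graph e ->
      injective id ->
      (forall v, id v < 2 ^ (c * (trunc_log 2 n).+1)) ->
      bcc_computes_mis_within A b e id
        (C * (trunc_log 2 (max_degree e)).+1 * (trunc_log 2 n).+1).
Proof.
move=> c; exists (algorithm_of (mis_protocol c)), (12 * c + 17).
exists (1 + 127 * (2 * c + 1) * (6 * (c + 5) + 4)) => n e id graph_e id_inj id_lt.
exact/spec_computes_mis/spec_mis_protocol.
Qed.
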